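(* Let $H$ be an infinite-dimensional separable complex Hilbert space and let $T:H\to H$ be a bounded linear operator such that the only closed subspaces of $H$ invariant under $T$ are $\{0\}$ and $H$. Let $x\in H$ be a nonzero vector, let $(\theta_n)_{n=1}^{\infty}$ be an orthonormal sequence in $H$, and let $(x_n)_{n=1}^{\infty}$ be a sequence in $H$ such that (1) $\operatorname{span}(\{\theta_1,\dots,\theta_n\})=\operatorname{span}(\{T(x),T^2(x),\dots,T^n(x)\})$ for each $n\in\mathbb{N}$; (2) $\operatorname{span}(\{\theta_1,\theta_2,\theta_3,\dots\})=\operatorname{span}(\{T(x),T^2(x),T^3(x),\dots\})$; (3) $x_n\neq 0$ for all $n\in\mathbb{N}$; (4) $\langle x_n,\theta_j\rangle=0$ for all $j\leq n$ in $\mathbb{N}$; (5) $x=x_n+\sum_{j=1}^n\langle x,\theta_j\rangle\theta_j$ for all $n\in\mathbb{N}$. For each $n\in\mathbb{N}$ set $y_n=x_n/\|x_n\|$. Then $(y_n)_{n=1}^{\infty}$ converges weakly to $0$, and consequently every subsequence of $(y_n)_{n=1}^{\infty}$ converges weakly to $0$; in particular, no subsequence of $(y_n)_{n=1}^{\infty}$ converges weakly to a nonzero vector of $H$.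
   Context: $\mathbb{N}=\{1,2,3,\dots\}$. The inner product $\langle\cdot,\cdot\rangle$ is linear in the first argument and conjugate-linear in the second, and $\|u\|=\sqrt{\langle u,u\rangle}$. For a nonempty subset $A$ of a vector space, $\operatorname{span}(A)$ is the (algebraic) subspace of all finite linear combinations of vectors from $A$. A subspace $S$ of $H$ is invariant under $T$ if $T(S)\subset S$. A sequence $(z_n)_{n=1}^{\infty}$ in $H$ converges weakly to $z\in H$ if $\lim_{n\to\infty}\langle z_n,h\rangle=\langle z,h\rangle$ for every $h\in H$. *)

(* Defs.v *)
From mathcomp Require Import all_boot all_order all_algebra.
From mathcomp Require Import complex.
From mathcomp Require Import all_classical all_reals all_analysis.

Set Implicit Arguments.
Unset Strict Implicit.
Unset Printing Implicit Defensive.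

Import Order.TTheory GRing.Theory Num.Theory numFieldNormedType.Exports.

Local Open Scope classical_set_scope.
Local Open Scope complex_scope.
Local Open Scope ring_scope.

(* Norms over the complex numbers R[i] take their values in R[i], in which
   [a <= b] means that [b - a] is a nonnegative real; a positive definite form
   [{dot H for Num.conj}] is linear in its first argument and conjugate-linear
   in its second.
   A complex Hilbert space is a complete normed R[i]-module [H] with such a
   form that induces the norm, in the following sense. *)
Definition induces_norm (R : realType) (H : normedModType R[i])
    (dot : {dot H for Num.conj}) : Prop :=
  forall u : H, `|u| = sqrtC (dot u u).

Definition is_subspace (R : realType) (H : lmodType R[i]) (S : set H) : Prop :=
  S 0 /\ forall (a : R[i]) (u v : H), S u -> S v -> S (a *: u + v).

Definition lin_span (R : realType) (H : lmodType R[i]) (A : set H) : set H :=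
  [set v | exists (n : nat) (a : 'I_n -> R[i]) (u : 'I_n -> H),
             (forall i, A (u i)) /\ v = \sum_(i < n) a i *: u i].

Definition infinite_dimensional (R : realType) (H : lmodType R[i]) : Prop :=
  forall F : set H, finite_set F -> lin_span F <> setT.

Definition separable (X : topologicalType) : Prop :=
  exists2 D : set X, countable D & dense D.

Definition bounded_operator (R : realType) (H : normedModType R[i])
    (T : {linear H -> H}) : Prop :=
  exists M : R, forall u : H, `|T u| <= M%:C * `|u|.

Definition invariant_under (H : Type) (T : H -> H) (S : set H) : Prop :=
  T @` S `<=` S.

Definition orthonormal_seq (R : realType) (H : lmodType R[i])
    (dot : {dot H for Num.conj}) (theta : nat -> H) : Prop :=
  forall i j : nat, dot (theta i) (theta j) = (i == j)%:R.

(* [R[i]^o] carries the topology of R[i] given by its absolute value. *)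
Definition weakly_cvg (R : realType) (H : lmodType R[i])
    (dot : {dot H for Num.conj}) (z_ : nat -> H) (z : H) : Prop :=
  forall h : H, (fun n => dot (z_ n) h : R[i]^o) @ \oo --> (dot z h : R[i]^o).

(* Main.v *)
Require Import Defs.
From mathcomp Require Import all_boot all_order all_algebra.
From mathcomp Require Import complex.
From mathcomp Require Import all_classical all_reals all_analysis.

Set Implicit Arguments.
Unset Strict Implicit.
Unset Printing Implicit Defensive.

Import Order.TTheory GRing.Theory Num.Theory numFieldNormedType.Exports.

Local Open Scope classical_set_scope.
Local Open Scope complex_scope.
Local Open Scope ring_scope.

(** The vectors y_n have norm 1 and y_n is orthogonal to theta_0, ..., theta_n.
    Hence for each v in the linear span L of all the theta_k, the numbers
    <y_n, v> vanish from some rank on.  A bounded sequence whose inner products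
    with the vectors of a dense set tend to 0 tends weakly to 0, by the
    Cauchy-Schwarz inequality ([weakly_cvg0_of_dense]), so it is enough that L be
    dense.  This is where T enters: L is also the span of T x, T^2 x, ..., which
    T maps into itself, so the closure of L is a closed subspace that is
    invariant under T ([invariant_closure_bounded]); it contains the unit vector
    theta_0, so it is not {0} and must be the whole space.

    Weak convergence passes to subsequences, and weak limits are unique, which
    gives the statements on subsequences. *)

Section Span.
Variables (R : realType) (H : lmodType R[i]).
Implicit Types (A S : set H) (v : H).

Lemma mem_lin_span A v : A v -> lin_span A v.
Proof.
move=> Av; exists 1%N, (fun=> 1), (fun=> v); split => //.
by rewrite big_ord1 scale1r.
Qed.

Lemma lin_span_is_subspace A : is_subspace (lin_span A).
Proof.
split; first by exists 0%N, (fun=> 0), (fun=> 0); split; [case|rewrite big_ord0].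
move=> a _ _ [m [b [u [Au ->]]]] [n [c [w [Aw ->]]]].
exists (m + n)%N, (fun i => match fintype.split i with
    | inl j => a * b j | inr k => c k end),
  (fun i => match fintype.split i with inl j => u j | inr k => w k end).
split; first by move=> i; case: (fintype.split i).
rewrite big_split_ord /= scaler_sumr; congr (_ + _); apply: eq_bigr => i _.
  by rewrite (unsplitK (inl i : 'I_m + 'I_n)%type) scalerA.
by rewrite (unsplitK (inr i : 'I_m + 'I_n)%type).
Qed.

Lemma lin_span_min A S : is_subspace S -> A `<=` S -> lin_span A `<=` S.
Proof.
move=> [S0 Scomb] AS _ [n [a [u [Au ->]]]].
apply: (big_ind S) => //.
  by move=> v w Sv Sw; rewrite -[v]scale1r; apply: Scomb.
by move=> i _; rewrite -[_ *: _]addr0; apply: Scomb => //; apply: AS.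
Qed.

Lemma invariant_lin_span A (T : {linear H -> H}) :
  invariant_under T A -> invariant_under T (lin_span A).
Proof.
move=> TA _ [v Lv <-].
apply: (@lin_span_min A (T @^-1` lin_span A)) Lv.
  have [L0 Lcomb] := lin_span_is_subspace A.
  split; first by rewrite /= linear0.
  by move=> a u w /= Lu Lw; rewrite linearP; apply: Lcomb.
by move=> u Au; apply/mem_lin_span/TA; exists u.
Qed.

End Span.

Section Closure.
Variables (R : realType) (H : normedModType R[i]).
Implicit Types (A S : set H).

Lemma closure_normP A (v : H) :
  closure A v <-> forall e : R[i], 0 < e -> exists2 w, A w & `|v - w| < e.
Proof.
split=> [clv e e0|Av B /nbhs_normP[e /= e0 eB]].
  have /clv[w [Aw vw]] : nbhs v [set w | `|v - w| < e] by apply/nbhs_normP; exists e.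
  by exists w.
by have [w Aw vw] := Av e e0; exists w; split => //; apply: eB.
Qed.

Lemma closure_is_subspace S : is_subspace S -> is_subspace (closure S).
Proof.
move=> [S0 Scomb]; split; first exact: subset_closure.
move=> a u v /closure_normP clu /closure_normP clv; apply/closure_normP => e e0.
have a1 : 0 < `|a| + 1 by rewrite ltr_wpDl.
have e2 : 0 < e / 2 by rewrite divr_gt0.
have [u' Su' uu'] := clu (e / 2 / (`|a| + 1)) (divr_gt0 e2 a1).
have [v' Sv' vv'] := clv (e / 2) e2.
exists (a *: u' + v'); first exact: Scomb.
rewrite opprD addrACA -scalerBr (le_lt_trans (ler_normD _ _))//.
rewrite [ltRHS]splitr ler_ltD// normrZ.
rewrite (@le_trans _ _ ((`|a| + 1) * `|u - u'|))//.
  by rewrite ler_wpM2r// lerDl.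
by rewrite mulrC -ler_pdivlMr// ltW.
Qed.

Lemma invariant_closure_bounded S (T : {linear H -> H}) :
  bounded_operator T -> invariant_under T S -> invariant_under T (closure S).
Proof.
move=> [M TM] TS _ [v /closure_normP clv <-]; apply/closure_normP => e e0.
have M1 : 0 < `|M%:C| + 1 :> R[i] by rewrite ltr_wpDl.
have [w Sw vw] := clv (e / (`|M%:C| + 1)) (divr_gt0 e0 M1).
exists (T w); first by apply: TS; exists w.
rewrite -linearB (le_lt_trans (TM _))//.
rewrite (@le_lt_trans _ _ ((`|M%:C| + 1) * `|v - w|))//.
  rewrite ler_wpM2r// (@le_trans _ _ `|M%:C|)// ?lerDl//.
  by apply: real_ler_norm; rewrite complex_real.
by rewrite mulrC -ltr_pdivlMr.
Qed.

End Closure.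

Section Weak.
Variables (R : realType) (H : normedModType R[i]) (dot : {dot H for Num.conj}).
Hypothesis hdot : induces_norm dot.

Lemma dot_normE (u : H) : dot u u = `|u| ^+ 2.
Proof. by rewrite hdot sqrtCK. Qed.

(** Subtracting from [u] its projection on [v] leaves a vector [w] orthogonal to
    [v], and Pythagoras gives
    [<u, u> = <w, w> + `|<u, v>|^2 / <v, v>] with [0 <= <w, w>]. *)
Lemma cauchy_schwarz (u v : H) : `|dot u v| <= `|u| * `|v|.
Proof.
have [->|v0] := eqVneq v 0; first by rewrite linear0r normr0 mulr_ge0.
have vv0 : 0 < dot v v by rewrite dnorm_gt0.
pose w := u - (dot u v / dot v v) *: v.
have wv : dot w v = 0.
  by rewrite linearBl linearZl_LR/= divfK ?subrr// gt_eqF.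
have : dot u u = dot w w + `|dot u v / dot v v| ^+ 2 * dot v v.
  rewrite -dnormZ -hnormDd ?subrK//.
  by rewrite linearZr_LR/= wv mulr0.
rewrite -(@ler_pXn2r _ 2) ?nnegrE ?mulr_ge0// exprMn -!dot_normE => ->.
rewrite mulrDl -[leLHS]add0r lerD ?mulr_ge0//.
rewrite normf_div [`|dot v v|]gtr0_norm// expr_div_n -mulrA -expr2 divfK//.
by rewrite expf_neq0// gt_eqF.
Qed.

(** A vector [h] is within [e / (C + 1)] of some [v] in [D], and
    [<z_n, h> = <z_n, h - v>] as soon as [<z_n, v> = 0].  Dividing by [C + 1]
    avoids a separate case for [C = 0]. *)
Lemma weakly_cvg0_of_dense (z_ : nat -> H) (C : R[i]) (D : set H) :
  (forall n, `|z_ n| <= C) -> closure D = setT ->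
  (forall v, D v -> \forall n \near \oo, dot (z_ n) v = 0) ->
  weakly_cvg dot z_ 0.
Proof.
move=> zC clD zD h; rewrite linear0l; apply/cvgrPdist_lt => e e0.
have C1 : 0 < C + 1 by rewrite ltr_wpDl// (le_trans _ (zC 0%N)).
have /closure_normP/(_ _ (divr_gt0 e0 C1))[v Dv hv] : closure D h by rewrite clD.
near=> n; rewrite sub0r normrN -[h](subrK v) linearDr/=.
have -> : dot (z_ n) v = 0 by near: n; exact: zD.
rewrite addr0 (le_lt_trans (cauchy_schwarz _ _))//.
rewrite (@le_lt_trans _ _ ((C + 1) * `|h - v|))//.
  by rewrite ler_wpM2r// (le_trans (zC n))// lerDl.
by rewrite mulrC -ltr_pdivlMr.
Unshelve. all: by end_near. Qed.

Lemma weakly_cvg_unique (z_ : nat -> H) (z z' : H) :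
  weakly_cvg dot z_ z -> weakly_cvg dot z_ z' -> z = z'.
Proof.
move=> cz cz'; apply/eqP; rewrite -subr_eq0 -(dnorm_eq0 dot).
rewrite linearBl subr_eq0; apply/eqP.
exact: (cvg_unique _ (cz (z - z')) (cz' (z - z'))).
Qed.

Lemma weakly_cvg_subseq (z_ : nat -> H) (z : H) (phi : nat -> nat) :
  {homo phi : m n / (m < n)%N} -> weakly_cvg dot z_ z ->
  weakly_cvg dot (z_ \o phi) z.
Proof.
move=> phiS cz h.
apply: (cvg_comp phi (fun n => dot (z_ n) h : R[i]^o)); last exact: cz.
have phi_ge n : (n <= phi n)%N.
  by elim: n => // n IHn; rewrite (leq_ltn_trans IHn)// phiS.
move=> P [N _ NP]; exists N => // n /= Nn.
by apply: NP; rewrite /= (leq_trans Nn).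
Qed.

End Weak.

(** [A] spans the same subspace as the iterates [T^k x] with [k >= 1], which [T]
    maps among themselves.  The closure of this subspace is therefore invariant,
    and it contains the nonzero vector [v]. *)
Lemma dense_lin_span (R : realType) (H : normedModType R[i])
    (T : {linear H -> H}) (A : set H) (x v : H) :
  bounded_operator T ->
  (forall S : set H, is_subspace S -> closed S ->
     invariant_under T S -> S = [set 0] \/ S = setT) ->
  lin_span A = lin_span (range (fun k : nat => iter k.+1 T x)) ->
  A v -> v != 0 -> closure (lin_span A) = setT.
Proof.
move=> hT hinv LE Av v0.
have TL : invariant_under T (lin_span A).
  rewrite LE; apply: invariant_lin_span => _ [_ [k _ <-] <-].
  by exists k.+1.
case: (hinv (closure (lin_span A))) => //.
- exact/closure_is_subspace/lin_span_is_subspace.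
- exact: closed_closure.
- exact: invariant_closure_bounded.
move=> cl0; have : closure (lin_span A) v by exact/subset_closure/mem_lin_span.
by rewrite cl0 => /eqP; rewrite (negPf v0).
Qed.

(* Sequences indexed by {1, 2, 3, ...} are shifted to nat: [theta k], [x_ k] and
   [y k] stand for the terms of index k + 1, and [iter k.+1 T x] is T^(k+1)(x). *)
Theorem mainTheorem1 (R : realType) (H : completeNormedModType R[i])
    (dot : {dot H for Num.conj}) (hdot : induces_norm dot)
    (hinf : infinite_dimensional H) (hsep : separable H)
    (T : {linear H -> H}) (hT : bounded_operator T)
    (hinv : forall S : set H, is_subspace S -> closed S ->
              invariant_under T S -> S = [set 0] \/ S = setT)
    (x : H) (hx : x != 0)
    (theta : nat -> H) (htheta : orthonormal_seq dot theta)
    (x_ : nat -> H)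
    (h1 : forall n : nat,
            lin_span [set theta k | k in [set k : nat | (k <= n)%N]]
            = lin_span [set iter k.+1 T x | k in [set k : nat | (k <= n)%N]])
    (h2 : lin_span (range theta)
          = lin_span (range (fun k : nat => iter k.+1 T x)))
    (h3 : forall n : nat, x_ n != 0)
    (h4 : forall n j : nat, (j <= n)%N -> dot (x_ n) (theta j) = 0)
    (h5 : forall n : nat,
            x = x_ n + \sum_(0 <= j < n.+1) dot x (theta j) *: theta j) :
  let y : nat -> H := fun n => `|x_ n|^-1 *: x_ n in
  [/\ weakly_cvg dot y 0,
      forall phi : nat -> nat, {homo phi : m n / (m < n)%N} ->
        weakly_cvg dot (y \o phi) 0
    & forall (phi : nat -> nat) (z : H), {homo phi : m n / (m < n)%N} ->
        z != 0 -> ~ weakly_cvg dot (y \o phi) z].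
Proof.
move=> y.
have dense_theta : closure (lin_span (range theta)) = setT.
  apply: (dense_lin_span hT hinv h2 (v := theta 0%N)); first by exists 0%N.
  by rewrite -(dnorm_eq0 dot) htheta eqxx oner_eq0.
have norm_y n : `|y n| <= 1.
  by rewrite normrZ normfV normr_id mulVf// normr_eq0.
have y_theta v : lin_span (range theta) v -> \forall n \near \oo, dot (y n) v = 0.
  move: v; apply: lin_span_min => [|_ [j _ <-]].
    split; first by near=> n; rewrite linear0r.
    move=> a u v u0 v0; near=> n.
    rewrite linearDr linearZr_LR/=.
    have -> : dot (y n) u = 0 by near: n.
    have -> : dot (y n) v = 0 by near: n.
    by rewrite mulr0 addr0.
  exists j => // n /= jn.
  by rewrite linearZl_LR/= h4// mulr0.
have cy : weakly_cvg dot y 0 by exact: weakly_cvg0_of_dense norm_y _ y_theta.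
split=> // [phi phiS|phi z phiS z0 cz]; first exact: weakly_cvg_subseq.
move/eqP: z0; apply.
exact: (weakly_cvg_unique cz (weakly_cvg_subseq phiS cy)).
Unshelve. all: by end_near. Qed.
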